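(* Let the 12 vertices of a regular icosahedron be labeled $N,S,U_1,\dots,U_5,L_1,\dots,L_5$, with $N$ and $S$ opposite and indices taken modulo $5$, and let $\mathcal{F}$ be the set of the ten triangles $F_S(i)=\triangle(S,U_i,L_i)$ and $F_N(i)=\triangle(N,U_i,L_{i-1})$, $i=1,\dots,5$ (with $L_0:=L_5$). Then no two distinct faces of $\mathcal{F}$ share an edge: for any $F_a,F_b\in\mathcal{F}$ with $F_a\neq F_b$, $$E(F_a)\cap E(F_b)=\varnothing.$$
   Context: The labels $N,S,U_1,\dots,U_5,L_1,\dots,L_5$ denote the 12 pairwise distinct vertices of the icosahedron. $\triangle(A,B,C)$ denotes the triangle with vertices $A,B,C$. For a triangle $F=\triangle(A,B,C)$, $E(F)=\{\{A,B\},\{B,C\},\{A,C\}\}$ is its set of edges, an edge being identified with the unordered pair of its endpoints. Sharing vertices is allowed. *)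

(* Defs.v *)
From HB Require Import structures.
From mathcomp Require Import all_boot all_order all_algebra.
From mathcomp Require Import finmap.

Set Implicit Arguments.
Unset Strict Implicit.
Unset Printing Implicit Defensive.

Import Order.TTheory GRing.Theory Num.Theory.
Local Open Scope fset_scope.
Local Open Scope ring_scope.

Section Triangles.
Variable P : choiceType.

(* The triangles that occur have distinct vertices; each is represented by
   the set of its vertices, so the order of the vertices is irrelevant. *)
Definition triangle (A B C : P) : {fset P} := [fset A; B; C].

Definition edges (F : {fset P}) : {fset {fset P}} :=
  [fset [fset A; B] | A in F, B in F & A != B].

Lemma edges_triangle (A B C : P) : uniq [:: A; B; C] ->
  edges (triangle A B C) = [fset [fset A; B]; [fset B; C]; [fset A; C]].
Proof.
rewrite /= !inE negb_or andbT => /andP[/andP[AB AC] BC].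
apply/fsetP => e; rewrite !inE; apply/imfset2P/idP.
  case=> x; rewrite !inE => xF [y]; rewrite !inE => /andP[yF xy] ->.
  move: xF yF xy => /orP[/orP[]|] /eqP-> /orP[/orP[]|] /eqP->;
    rewrite ?eqxx // => _; rewrite ?[[fset B; A]]fsetUC ?[[fset C; A]]fsetUC
      ?[[fset C; B]]fsetUC ?eqxx ?orbT //.
case/orP=> [/orP[]|] /eqP->.
- exists A; first by rewrite !inE eqxx.
  by exists B; rewrite // !inE eqxx AB !orbT.
- exists B; first by rewrite !inE eqxx !orbT.
  by exists C; rewrite // !inE eqxx BC !orbT.
- exists A; first by rewrite !inE eqxx.
  by exists C; rewrite // !inE eqxx AC !orbT.
Qed.

End Triangles.

Section Icosahedron.
Variable R : rcfType.
Notation point := 'rV[R]_3.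

Definition golden : R := (1 + Num.sqrt 5) / 2.

Definition pt3 (x y z : R) : point := \row_(j < 3) [:: x; y; z]`_j.

(* The cyclic permutations of (0, +-1, +-golden). *)
Definition std_icosahedron : seq point :=
  [seq pt3 0 s (t * golden) | s <- [:: 1; -1], t <- [:: 1; -1]] ++
  [seq pt3 s (t * golden) 0 | s <- [:: 1; -1], t <- [:: 1; -1]] ++
  [seq pt3 (t * golden) 0 s | s <- [:: 1; -1], t <- [:: 1; -1]].

(* V is the vertex set of a regular icosahedron: an image of the standard one
   under a similarity of the space. *)
Definition regular_icosahedron (V : {fset point}) : Prop :=
  exists (c : point) (r : R) (Q : 'M[R]_3),
    [/\ 0 < r, Q *m Q^T = 1%:M &
        V = [fset c + r *: (x *m Q) | x in std_icosahedron]].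

Definition centroid (V : {fset point}) : point :=
  (#|` V|)%:R^-1 *: \sum_(x <- V) x.

Definition opposite (V : {fset point}) (A B : point) : Prop :=
  A - centroid V = - (B - centroid V).

(* Indices live in 'Z_5 = {0, .., 4}, with 0 in the role of 5, so that
   L (i - 1) at i = 1 is L_0 = L_5. *)
Definition labels (N S : point) (U L : 'Z_5 -> point) : seq point :=
  [:: N, S & codom U ++ codom L].

Definition faceS (S : point) (U L : 'Z_5 -> point) (i : 'Z_5) :=
  triangle S (U i) (L i).

Definition faceN (N : point) (U L : 'Z_5 -> point) (i : 'Z_5) :=
  triangle N (U i) (L (i - 1)).

Definition ten_faces (N S : point) (U L : 'Z_5 -> point) :
    {fset {fset point}} :=
  [fset faceS S U L i | i : 'Z_5] `|` [fset faceN N U L i | i : 'Z_5].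

End Icosahedron.

(* Main.v *)
Require Import Defs.
From mathcomp Require Import all_boot all_order all_algebra.
From mathcomp Require Import finmap.

Set Implicit Arguments.
Unset Strict Implicit.
Unset Printing Implicit Defensive.

Import Order.TTheory GRing.Theory Num.Theory.
Local Open Scope fset_scope.
Local Open Scope ring_scope.

(** The reason is combinatorial: every face consists of a pole, one U-vertex
    and one L-vertex, so two faces can only have a pole, a U-vertex or
    an L-vertex in common ([common_vertex]). A face is determined by any two of
    its three vertices: the pole and either index determine the other index, and
    the difference of the indices of the U-vertex and the L-vertex (0 at S, 1 at
    N) determines the pole. Hence distinct faces have at most one common vertex,
    whereas a common edge would provide two ([edges_disjoint]). *)

Section CommonVertices.
Variable P : choiceType.

(** The endpoints of an edge of [F] are distinct vertices of [F], and they can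
    be recovered from the edge as a set; a shared edge is thus a pair of
    distinct shared vertices. *)
Lemma edges_disjoint (F G : {fset P}) :
    {in F `&` G &, forall x y, x = y} ->
  edges F `&` edges G = fset0.
Proof.
move=> common_eq; apply/fsetP => e; rewrite !inE; apply/negP.
case/andP=> /imfset2P[x xF [y /[!inE] /andP[yF xy] ->]].
case/imfset2P=> z zG [t /[!inE] /andP[tG _] ezt].
have inG w : w \in [fset x; y] -> w \in G.
  by rewrite ezt !inE => /orP[] /eqP->.
move/eqP: xy; apply; apply: common_eq.
  by rewrite inE xF inG // !inE eqxx.
by rewrite inE yF inG // !inE eqxx orbT.
Qed.

(** The side conditions say that the three positions in a triangle are of
    different kinds, so that a common vertex occupies the same position in both
    triangles. *)
Lemma common_vertex (A B C A' B' C' x : P) :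
    [/\ A != B', A != C' & B != C'] -> [/\ A' != B, A' != C & B' != C] ->
    x \in triangle A B C `&` triangle A' B' C' ->
  [\/ x = A /\ A = A', x = B /\ B = B' | x = C /\ C = C'].
Proof.
move=> [/eqP AB /eqP AC /eqP BC] [/eqP A'B /eqP A'C /eqP B'C].
rewrite !inE => /andP[/orP[/orP[]|] /eqP-> /orP[/orP[]|] /eqP E];
  by [constructor 1 | constructor 2 | constructor 3 | move/esym: E].
Qed.

End CommonVertices.

Section Faces.
Variable R : rcfType.
Variables (N S : 'rV[R]_3) (U L : 'Z_5 -> 'rV[R]_3).

Definition pole (b : bool) := if b then N else S.

(** Shifting the index of the L-vertex by [b] puts both kinds of faces into one
    formula, so that the pole is encoded in the difference of the indices. *)
Definition face (b : bool) (i : 'Z_5) :=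
  triangle (pole b) (U i) (L (i - b%:R)).

Lemma ten_facesP F : F \in ten_faces N S U L -> exists b i, F = face b i.
Proof.
rewrite inE => /orP[] /imfsetP[i _ ->]; [exists false | exists true]; exists i.
  by rewrite /face subr0.
by [].
Qed.

Hypothesis labels_uniq : uniq (labels N S U L).

Lemma pole_inj : injective pole.
Proof.
move: labels_uniq; rewrite /= inE negb_or => /and3P[/andP[/eqP NS _] _ _].
by case=> [] [] //= E; case: NS.
Qed.

Lemma U_inj : injective U.
Proof.
by move: labels_uniq; rewrite /= cat_uniq => /and5P[_ _ /injectiveP].
Qed.

Lemma L_inj : injective L.
Proof.
by move: labels_uniq; rewrite /= cat_uniq => /and5P[_ _ _ _ /injectiveP].
Qed.

Lemma pole_neqU b i : pole b != U i.
Proof.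
have Ui : U i \in codom U ++ codom L by rewrite mem_cat codom_f.
move: labels_uniq; rewrite /= inE negb_or => /and3P[/andP[_ NUL] SUL _].
by case: b; [apply: contraNneq NUL | apply: contraNneq SUL] => /= ->.
Qed.

Lemma pole_neqL b i : pole b != L i.
Proof.
have Li : L i \in codom U ++ codom L by rewrite mem_cat codom_f orbT.
move: labels_uniq; rewrite /= inE negb_or => /and3P[/andP[_ NUL] SUL _].
by case: b; [apply: contraNneq NUL | apply: contraNneq SUL] => /= ->.
Qed.

Lemma U_neqL i j : U i != L j.
Proof.
move: labels_uniq; rewrite /= cat_uniq => /and5P[_ _ _ /hasPn disjUL _].
by apply: contraNneq (disjUL _ (codom_f L j)) => <-; apply: codom_f.
Qed.

Lemma common_face_vertex b i c j x : x \in face b i `&` face c j ->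
  [\/ x = pole b /\ b = c, x = U i /\ i = j |
      x = L (i - b%:R) /\ i - b%:R = j - c%:R].
Proof.
case/common_vertex=> [||[-> /pole_inj]|[-> /U_inj]|[-> /L_inj]];
  try by split; rewrite ?pole_neqU ?pole_neqL ?U_neqL.
- by constructor 1.
- by constructor 2.
- by constructor 3.
Qed.

Lemma bool_natr_inj : injective (fun b : bool => b%:R : 'Z_5).
Proof. by case=> [] []. Qed.

(** Two common vertices in different positions give two of the equations
    [b = c], [i = j] and [i - b%:R = j - c%:R], and any two of these imply that
    the faces coincide. *)
Lemma distinct_faces_meet b i c j : face b i <> face c j ->
  {in face b i `&` face c j &, forall x y, x = y}.
Proof.
move=> neq x y /common_face_vertex xP /common_face_vertex yP.
have bi_neq : b = c -> i = j -> False by move=> ebc eij; rewrite ebc eij in neq.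
have bd_neq : b = c -> i - b%:R = j - c%:R -> False.
  by move=> ebc; rewrite ebc => /addIr; apply: bi_neq.
have id_neq : i = j -> i - b%:R = j - c%:R -> False.
  move=> eij; rewrite eij => /addrI/oppr_inj/bool_natr_inj ebc.
  exact: bi_neq.
by case: xP yP => [][-> ex] [][-> ey] //; exfalso; auto.
Qed.

End Faces.

Theorem theorem2 (R : rcfType) (V : {fset 'rV[R]_3})
    (N S : 'rV[R]_3) (U L : 'Z_5 -> 'rV[R]_3)
    (icoV : regular_icosahedron V)
    (labels_uniq : uniq (labels N S U L))
    (labelsV : V = [fset x in labels N S U L])
    (oppNS : opposite V N S)
    (Fa Fb : {fset 'rV[R]_3})
    (FaF : Fa \in ten_faces N S U L) (FbF : Fb \in ten_faces N S U L)
    (neqF : Fa <> Fb) :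
  edges Fa `&` edges Fb = fset0.
Proof.
have [b [i eFa]] := ten_facesP FaF; have [c [j eFb]] := ten_facesP FbF.
by subst Fa Fb; apply: edges_disjoint; apply: distinct_faces_meet.
Qed.
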